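(* Let $g:\mathds{R}^d\setminus\{0\}\to[0,\infty)$ be continuous. Then the set $\mathcal{C}_c(\mathds{R}^d,\mathcal{M}^+(\mathds{R}^d\setminus\{0\}))\cap K^g(\mathds{R}^d,\mathcal{M}^+(\mathds{R}^d\setminus\{0\}))$ is bp-dense in $K^g(\mathds{R}^d,\mathcal{M}^+(\mathds{R}^d\setminus\{0\}))$, i.e. the smallest subset of $K^g$ containing it and closed under bp-limits of sequences is all of $K^g$.
   Context: $\mathcal{M}^+(\mathds{R}^d\setminus\{0\})$ is the set of positive locally finite (Radon) measures on $\mathds{R}^d\setminus\{0\}$ with the vague topology (induced by $\mathcal{C}_c(\mathds{R}^d\setminus\{0\})$). $K^g(\mathds{R}^d,\mathcal{M}^+(\mathds{R}^d\setminus\{0\}))$ is the set of measurable maps $\mu:\mathds{R}^d\to\mathcal{M}^+(\mathds{R}^d\setminus\{0\})$ (equivalently $x\mapsto\int f\,d\mu(x)$ measurable for all $f\in\mathcal{C}_c(\mathds{R}^d\setminus\{0\})$) such that $\|\mu\|_g:=\sup_x\int g(y)\mu(x,dy)<\infty$ and $\lim_{R\to\infty}\sup_{x\in K}\mu(x,\{|y|>R\})=0$ for every compact $K\subset\mathds{R}^d$. $\mathcal{C}_c(\mathds{R}^d,\mathcal{M}^+)$ denotes vaguely continuous maps vanishing (i.e. equal to the zero measure) outside a compact set. A sequence $(\mu_n)\subset K^g$ converges boundedly and pointwise (bp) to $\mu:\mathds{R}^d\to\mathcal{M}^+$ if $\sup_n\|\mu_n\|_g<\infty$, $\mu_n(x)\to\mu(x)$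 vaguely for every $x$, and $\lim_{R\to\infty}\sup_n\sup_{x\in K}\mu_n(x,\{|y|>R\})=0$ for every compact $K$. *)

(* Defs.v *)
From HB Require Import structures.
From mathcomp Require Import all_boot all_order all_algebra.
From mathcomp Require Import all_classical all_reals all_analysis.
From mathcomp Require Import measurable_realfun.
Set Implicit Arguments. Unset Strict Implicit. Unset Printing Implicit Defensive.
Import Order.TTheory GRing.Theory Num.Theory.
Import numFieldNormedType.Exports.
Local Open Scope classical_set_scope.
Local Open Scope ring_scope.

Definition Bd (R : realType) (d : nat) := g_sigma_algebraType (@open 'rV[R]_d).

Definition enorm (R : realType) (d : nat) (y : 'rV[R]_d) : R :=
  Num.sqrt (\sum_(i < d) y ord0 i ^+ 2).

(* A (positive Borel) measure on R^d\{0}, encoded as a Borel measure on R^d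
   not charging {0}. *)
Definition msr (R : realType) (d : nat) := {measure set (Bd R d) -> \bar R}.

Definition Mplus (R : realType) (d : nat) (m : msr R d) : Prop :=
  m ([set (0%R : 'rV[R]_d)] : set (Bd R d)) = 0%E /\
  forall K : set 'rV[R]_d, compact K -> ~ K 0 -> (m K < +oo)%E.

(* C_c(R^d\{0}), extended by 0 to R^d: continuous, with support contained in
   a compact subset of R^d\{0}. *)
Definition Cc0 (R : realType) (d : nat) (f : 'rV[R]_d -> R) : Prop :=
  continuous f /\
  exists K : set 'rV[R]_d, [/\ compact K, ~ K 0 & forall y, ~ K y -> f y = 0].

Definition pair (R : realType) (d : nat) (m : msr R d) (f : 'rV[R]_d -> R) : \bar R :=
  (\int[m]_(y in [set: Bd R d]) (f y)%:E)%E.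

Definition gint (R : realType) (d : nat) (m : msr R d) (g : 'rV[R]_d -> R) : \bar R :=
  (\int[m]_(y in (~` [set (0%R : 'rV[R]_d)] : set (Bd R d))) (g y)%:E)%E.

Definition kern (R : realType) (d : nat) := 'rV[R]_d -> msr R d.

Definition kern_measurable (R : realType) (d : nat) (mu : kern R d) : Prop :=
  forall f, Cc0 f -> measurable_fun [set: Bd R d] (fun x : Bd R d => pair (mu x) f).

Definition Kg (R : realType) (d : nat) (g : 'rV[R]_d -> R) : set (kern R d) :=
  [set mu | [/\ forall x, Mplus (mu x),
     kern_measurable mu,
     (exists M : R, forall x, (gint (mu x) g <= M%:E)%E) &
     forall K : set 'rV[R]_d, compact K -> forall e : R, 0 < e ->
       exists R0 : R, forall r : R, R0 <= r -> forall x, K x ->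
         (mu x ([set y | (r < enorm y)%R] : set (Bd R d)) <= e%:E)%E]].

(* C_c(R^d, M^+): vaguely continuous, equal to the zero measure outside a
   compact set. Vague continuity = continuity of every x |-> <f, mu x>. *)
Definition Ccv (R : realType) (d : nat) : set (kern R d) :=
  [set mu | (forall x, Mplus (mu x)) /\
    (forall f, Cc0 f -> continuous (fun x : 'rV[R]_d => pair (mu x) f)) /\
    exists K : set 'rV[R]_d, compact K /\
      forall x, ~ K x -> forall A, mu x A = 0%E].

Definition bp_cvg (R : realType) (d : nat) (g : 'rV[R]_d -> R)
    (mun : nat -> kern R d) (mu : kern R d) : Prop :=
  [/\ (exists M : R, forall n x, (gint (mun n x) g <= M%:E)%E),
      (forall x f, Cc0 f -> pair (mun n x) f @[n --> \oo] --> pair (mu x) f) &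
      forall K : set 'rV[R]_d, compact K -> forall e : R, 0 < e ->
       exists R0 : R, forall r : R, R0 <= r -> forall n x, K x ->
         (mun n x ([set y | (r < enorm y)%R] : set (Bd R d)) <= e%:E)%E].

Definition bp_closed (R : realType) (d : nat) (g : 'rV[R]_d -> R)
    (S : set (kern R d)) : Prop :=
  forall (mun : nat -> kern R d) (mu : kern R d),
    (forall n, S (mun n)) -> Kg g mu -> bp_cvg g mun mu -> S mu.

(* Main.v *)
Require Import Defs.
From HB Require Import structures.
From mathcomp Require Import all_boot all_order all_algebra.
From mathcomp Require Import all_classical all_reals all_analysis.
From mathcomp Require Import measurable_realfun.
Import Order.TTheory GRing.Theory Num.Theory.
Import numFieldNormedType.Exports.
Local Open Scope classical_set_scope.
Local Open Scope ring_scope.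

Set Implicit Arguments.
Unset Strict Implicit.
Unset Printing Implicit Defensive.

(** A measure [mu x] is discretized in [y]: a partition of unity [psi_j] of mesh
    [1/n] on the shell [1/n <= |y| <= n] gives
    [nu_n x = sum_j (int psi_j d(mu x)) delta_(y_j)].  Taking for [y_j] a
    minimizer of [g] on the cell of [psi_j] makes the bound on [int g] pass from
    [mu] to [nu_n], and dominated convergence gives [nu_n x -> mu x] vaguely.
    With the points [y_j] fixed, such a kernel only depends on finitely many
    measurable coefficients.  These are truncated to bounded functions of
    compact support and then replaced one at a time by continuous functions,
    because every Borel function belongs to the smallest class that contains
    the continuous functions and is closed under pointwise limits of
    sequences. *)

(** * Continuity of minimum and maximum *)

Lemma minr_continuous (R : realType) :
  continuous (fun z : R * R => Num.min z.1 z.2).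
Proof. by move=> z; exact: (@continuous_min _ _ fst snd z cvg_fst cvg_snd). Qed.

Lemma maxr_continuous (R : realType) :
  continuous (fun z : R * R => Num.max z.1 z.2).
Proof. by move=> z; exact: (@continuous_max _ _ fst snd z cvg_fst cvg_snd). Qed.

Lemma cvg_minr (R : realType) (T : Type) (F : set_system T) (FF : Filter F)
    (f g : T -> R) (a b : R) :
  f @ F --> a -> g @ F --> b -> Num.min (f x) (g x) @[x --> F] --> Num.min a b.
Proof. by apply: continuous2_cvg; exact: (@minr_continuous R (a, b)). Qed.

Lemma cvg_maxr (R : realType) (T : Type) (F : set_system T) (FF : Filter F)
    (f g : T -> R) (a b : R) :
  f @ F --> a -> g @ F --> b -> Num.max (f x) (g x) @[x --> F] --> Num.max a b.
Proof. by apply: continuous2_cvg; exact: (@maxr_continuous R (a, b)). Qed.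

(** * Baire functions *)

Section Baire.
Context (R : realType) (T : pseudoMetricType R).

(** Generating the class inductively provides an induction principle that can be run against any
    property stable under pointwise limits, in particular membership in a bp-closed set of
    kernels. *)
Inductive baire : (T -> R) -> Prop :=
| baire_continuous f : continuous f -> baire f
| baire_lim (F : nat -> T -> R) f : (forall n, baire (F n)) ->
    (forall x, F n x @[n --> \oo] --> f x) -> baire f.

(** Since [h] is continuous, it commutes with limits taken in one argument at a time: an induction
    on [f] for all [g], then, for [f] continuous, an induction on [g]. *)
Lemma baire_comp2 (h : R -> R -> R) (f g : T -> R) :
  continuous (fun z : R * R => h z.1 z.2) -> baire f -> baire g ->
  baire (fun x => h (f x) (g x)).
Proof.
move=> ch bf; elim: bf g => {f} [f cf|F f _ IH Ff] g bg; last first.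
  apply: (@baire_lim (fun n x => h (F n x) (g x))) => [n|x]; first exact: IH.
  by apply: continuous2_cvg; [exact: (ch (f x, g x))|exact: Ff|exact: cvg_cst].
elim: bg => {g} [g cg|G g _ IH Gg].
  apply: baire_continuous => x.
  by apply: continuous2_cvg; [exact: (ch (f x, g x))|exact: cf|exact: cg].
apply: (@baire_lim (fun n x => h (f x) (G n x))) => [n|x]; first exact: IH.
by apply: continuous2_cvg; [exact: (ch (f x, g x))|exact: cvg_cst|exact: Gg].
Qed.

Lemma baireD (f g : T -> R) : baire f -> baire g -> baire (f \+ g).
Proof. by apply: baire_comp2; exact: add_continuous. Qed.

Lemma baireM (f g : T -> R) : baire f -> baire g -> baire (f \* g).
Proof. by apply: baire_comp2; exact: mul_continuous. Qed.

Lemma baire_cst (c : R) : baire (fun=> c).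
Proof. by apply: baire_continuous => x; exact: cvg_cst. Qed.

(** The continuous functions [min 1 (n * D x)], with [D] a truncated distance to the complement of
    [U], are [0] off [U] and eventually [1] at each point of [U]. *)
Lemma baire_indic_open (U : set T) : open U -> baire \1_U.
Proof.
move=> oU; have [CU0|/set0P[a0 Ca0]] := eqVneq (~` U) set0.
  suff -> : \1_U = (fun=> 1) :> (T -> R) by exact: baire_cst.
  by rewrite -(setCK U) CU0 setC0; apply/funext => x; rewrite indicE in_setT.
(* Capping the extended distance at 1 makes it finite, so that continuity survives [fine]. *)
pose D x := fine (Order.min (edist_inf (~` U) x) 1%:E).
have Dfin x : Order.min (edist_inf (~` U) x) 1%:E \is a fin_num.
  rewrite ge0_fin_numE ?le_min ?edist_inf_ge0 ?lee01//.
  by rewrite gt_min ltry orbT.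
have cD : continuous D.
  move=> x; apply: fine_cvg; rewrite fineK//.
  apply: continuous2_cvg; last exact: cvg_cst.
    exact: (@min_continuous _ (\bar R) (edist_inf (~` U) x, 1%:E)).
  exact: edist_inf_continuous.
have D0 x : 0 <= D x by rewrite fine_ge0// le_min edist_inf_ge0 lee01.
apply: (@baire_lim (fun n x => Num.min 1 (n%:R * D x))) => [n|x].
  apply: baire_continuous => x.
  apply: (@cvg_minr _ _ _ (nbhs_filter x)); first exact: cvg_cst.
  by apply: cvgM; [exact: cvg_cst|exact: cD].
rewrite indicE; have [/set_mem Ux|/negP xU] := boolP (x \in U); last first.
  have -> : D x = 0.
    by rewrite /D edist_inf0 ?min_l ?lee01// => ?; apply: xU; exact/mem_set.
  apply: cvg_near_cst; near=> n; rewrite mulr0.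
  by rewrite min_r.
have Dx : 0 < D x.
  rewrite fine_gt0//; apply/andP; split; last by rewrite gt_min ltry orbT.
  rewrite lt_min lte01 andbT.
  have /nbhs_ballP[e /= e0 eU] : nbhs x U by exact: open_nbhs_nbhs.
  apply: (@lt_le_trans _ _ e%:E); first by rewrite lte_fin.
  apply: le_ereal_inf_tmp => _ [z /= Uz <-]; rewrite leNgt; apply/negP.
  by move=> /edist_lt_ball /eU.
apply: cvg_near_cst; near=> n; rewrite min_l//.
rewrite -ler_pdivrMr// div1r.
near: n; exact: nbhs_infty_ger.
Unshelve. all: by end_near. Qed.

End Baire.

(** The sets with a Baire indicator contain the open sets and form a sigma-algebra: complements and
    finite unions are algebraic, and countable unions are pointwise limits of finite ones. *)
Lemma baire_indic (R : realType) (d : nat) (A : set (Bd R d)) :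
  measurable A -> baire (\1_A : 'rV[R]_d -> R).
Proof.
set T := 'rV[R]_d.
move: A; apply: smallest_sub => [|B oB]; last exact: baire_indic_open.
split.
- rewrite /= indic0; exact: baire_cst.
- move=> A bA; rewrite /= setTD.
  suff -> : \1_(~` A) = (fun=> 1) \+ ((fun=> -1) \* \1_A) :> (T -> R).
    by apply: baireD; [|apply: baireM => //]; exact: baire_cst.
  apply/funext => x; rewrite /= !indicE in_setC mulN1r.
  by case: (x \in A); rewrite ?subrr ?subr0.
- move=> A bA.
  apply: (@baire_lim _ _ (fun n => \1_(\big[setU/set0]_(i < n) A i))) => [n|x].
    elim: n => [|n IH]; first by rewrite big_ord0 indic0; exact: baire_cst.
    rewrite big_ord_recr/=.
    set B := \big[_/_]_(_ < _) _.
    (* Inclusion-exclusion for two sets. *)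
    suff -> : \1_(B `|` A n) =
      (\1_B \+ \1_(A n)) \+ ((fun=> -1) \* (\1_B \* \1_(A n))) :> (T -> R).
      by do ?[apply: baireD|apply: baireM] => //; exact: baire_cst.
    apply/funext => x; rewrite /= !indicE in_setU.
    by case: (x \in B); case: (x \in A n);
      rewrite /= ?(mulr0,mulr1,addr0,add0r) ?addrK.
  apply: cvg_near_cst.
  have [/set_mem [k _ Akx]|/negP xA] := boolP (x \in \bigcup_k A k).
    near=> n; rewrite !indicE [x \in \bigcup_k A k]mem_set; last by exists k.
    rewrite mem_set// -bigcup_mkord; exists k => //=; near: n.
    exact: nbhs_infty_gt.
  near=> n; rewrite !indicE [x \in \bigcup_k A k]memNset; last first.
    by move=> h; apply: xA; exact/mem_set.
  rewrite memNset// -bigcup_mkord => -[k _ Akx].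
  by apply: xA; apply/mem_set; exists k.
Unshelve. all: by end_near. Qed.

Import HBNNSimple.

(** A nonnegative measurable function is a pointwise limit of simple functions, and these are finite
    linear combinations of indicators of Borel sets. *)
Lemma baire_measurable (R : realType) (d : nat) (f : 'rV[R]_d -> R) :
  measurable_fun [set: Bd R d] (f : Bd R d -> R) -> (forall x, 0 <= f x) ->
  baire f.
Proof.
move=> mf f0.
have mf' := (@measurable_EFinP _ (Bd R d) _ _ _).2 mf.
pose F := nnsfun_approx measurableT mf'.
apply: (@baire_lim R _ (fun n => F n)) => [n|x]; last first.
  have Fx : (F n x)%:E @[n --> \oo] --> (f x)%:E.
    by apply: (cvg_nnsfun_approx measurableT mf') => // y _; rewrite lee_fin.
  exact: (fine_cvg Fx).
have -> : (F n : 'rV[R]_d -> R) = fun x : 'rV[R]_d =>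
    \sum_(y \in range (F n)) y * \1_(F n @^-1` [set y]) x.
  by apply/funext => x; rewrite fimfunE.
under eq_fun do rewrite fsbig_finite//=.
elim: (finmap.enum_fset _) => [|y s IH].
  by under eq_fun do rewrite big_nil; exact: baire_cst.
under eq_fun do rewrite big_cons; apply: baireD => //; apply: baireM => //.
  exact: baire_cst.
exact: baire_indic.
Qed.

(** * Borel sets and norms *)

Section Borel_rV.
Context (R : realType) (d : nat).
Local Notation X := 'rV[R]_d.

Lemma Bd_measurable_open (U : set X) : open U -> measurable (U : set (Bd R d)).
Proof. by move=> oU; exact: sub_sigma_algebra. Qed.

Lemma Bd_measurable_compact (K : set X) :
  compact K -> measurable (K : set (Bd R d)).
Proof.
move=> cK; rewrite -(setCK K); apply: measurableC; apply: Bd_measurable_open.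
by rewrite openC; apply: compact_closed => //; exact: norm_hausdorff.
Qed.

(** The relative form is meant for [g], which is continuous only on the complement of the origin. *)
Lemma Bd_measurable_fun_within (D : set X) (f : X -> R) : open D ->
  {within D, continuous f} ->
  measurable_fun (D : set (Bd R d)) (f : Bd R d -> R).
Proof.
move=> oD; rewrite continuous_open_subspace// => cf.
apply: (measurability _ (RGenOpens.measurableE R)) => //.
move=> _ [_ [x [y ->]] <-]; apply: Bd_measurable_open.
by apply: (iffLR (continuous_inP _ oD)) => //; exact: interval_open.
Qed.

Lemma Bd_measurable_fun (f : X -> R) : continuous f ->
  measurable_fun [set: Bd R d] (f : Bd R d -> R).
Proof.
move=> cf; apply: Bd_measurable_fun_within; first exact: openT.
exact: continuous_subspaceT.
Qed.

(** This keeps kernels with Baire coefficients in [Kg], where [bp_closed] wants its limits to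
    lie. *)
Lemma baire_Bd_measurable (f : X -> R) : baire f ->
  measurable_fun [set: Bd R d] (f : Bd R d -> R).
Proof.
elim=> {f} [f cf|F f _ IH Ff]; first exact: Bd_measurable_fun.
by apply: (@measurable_fun_cvg _ _ _ _ (fun n => F n : Bd R d -> R)).
Qed.

Lemma open_neq0 : open (~` [set (0 : X)]).
Proof.
rewrite openC; apply: accessible_closed_set1.
exact: hausdorff_accessible (@norm_hausdorff _ _).
Qed.

Lemma norm_coord_le (y : X) i : `|y ord0 i| <= `|y|.
Proof.
rewrite [leRHS]/Num.norm/= mx_normrE.
exact: (@le_bigmax _ _ _ _ (fun ij : 'I_1 * 'I_d => `|y ij.1 ij.2|) (ord0, i)).
Qed.

Lemma norm_le_enorm (y : X) : `|y| <= enorm y.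
Proof.
rewrite [leLHS]/Num.norm/= mx_normrE; apply/bigmax_leP; split=> [|[i j] _ /=].
  exact: sqrtr_ge0.
rewrite ord1 -sqrtr_sqr ler_wsqrtr// (bigD1 j)//= lerDl sumr_ge0// => k _.
exact: sqr_ge0.
Qed.

(** Each of the [d] squared coordinates is at most the square of the sup norm, and [d <= d.+1 ^ 2].
    The constant is crude, but it is positive even for [d = 0], which the tail estimate uses. *)
Lemma enorm_le_norm (y : X) : enorm y <= d.+1%:R * `|y|.
Proof.
rewrite -(@ger0_norm _ (_ * _)) ?mulr_ge0// -sqrtr_sqr ler_wsqrtr//.
apply: (@le_trans _ _ (\sum_(i < d) `|y| ^+ 2)).
  apply: ler_sum => i _; rewrite -[leLHS]ger0_norm ?sqr_ge0// normrX.
  by rewrite lerXn2r ?nnegrE// norm_coord_le.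
rewrite sumr_const card_ord -[leLHS]mulr_natl exprMn.
rewrite ler_wpM2r ?sqr_ge0// -natrX ler_nat.
by rewrite (leq_trans (leqnSn d))// expnS expn1 leq_pmulr.
Qed.

Lemma enorm_continuous : continuous (@enorm R d).
Proof.
rewrite /enorm => x.
apply: (@continuous_comp _ _ _ (fun y : X => \sum_(i < d) y ord0 i ^+ 2)).
  apply: (@continuous_big _ _ +%R 0 xpredT) => [|i _ {}x].
    exact: add_continuous.
  apply: (@continuous_comp _ _ _ (fun y : X => y ord0 i) (fun t : R => t ^+ 2)).
    exact: coord_continuous.
  exact: exprn_continuous.
exact: sqrt_continuous.
Qed.

Lemma enorm_gt_measurable (r : R) :
  measurable ([set y | r < enorm y] : set (Bd R d)).
Proof.
apply: Bd_measurable_open.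
rewrite -[[set y | _]]/(@enorm R d @^-1` [set t | r < t]).
by apply: open_comp => [y _|]; [exact: enorm_continuous|exact: open_gt].
Qed.

Lemma closed_normball_compact (r : R) : compact [set x : X | `|x| <= r].
Proof.
apply: bounded_closed_compact.
  exists r; split=> [|M rM x /= /le_trans]; first exact: num_real.
  by apply; exact: ltW.
rewrite -[[set x | _]]/((Num.norm : X -> R) @^-1` [set t | t <= r]).
by apply: closed_comp => [y _|]; [exact: norm_continuous|exact: closed_le].
Qed.

Lemma shell_compact (r s : R) : compact [set x : X | r <= `|x| <= s].
Proof.
have -> : [set x : X | r <= `|x| <= s] =
    ((Num.norm : X -> R) @^-1` [set t | r <= t]) `&` [set x | `|x| <= s].
  by apply/seteqP; split=> x /=; [move/andP|move=> [-> ->]].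
rewrite setIC; apply: compact_closedI; first exact: closed_normball_compact.
by apply: closed_comp => [y _|]; [exact: norm_continuous|exact: closed_ge].
Qed.

End Borel_rV.

(** * Kernels with finitely many atoms *)

Section Dirac_kernels.
Context (R : realType) (d : nat).
Local Notation X := 'rV[R]_d.
Implicit Types (m : nat) (a : nat -> X -> R) (y : nat -> X).

(* The absolute value supplies the nonnegativity that [mscale] asks for. *)
Definition diracs m a y : kern R d := fun x =>
  msum (fun i => mscale `|a i x|%:nng (dirac (y i : Bd R d))) m.

Lemma diracsE m a y x A :
  diracs m a y x A = (\sum_(i < m) `|a i x|%:E * \d_(y i : Bd R d) A)%E.
Proof. by []. Qed.

Lemma ge0_integral_diracs m a y x (D : set (Bd R d)) (f : Bd R d -> \bar R) :
  measurable D -> measurable_fun D f -> (forall z, D z -> 0 <= f z)%E ->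
  (\int[diracs m a y x]_(z in D) f z =
   \sum_(i < m) `|a i x|%:E * (\d_(y i : Bd R d) D * f (y i)))%E.
Proof.
move=> mD mf f0; rewrite ge0_integral_measure_sum//; apply: eq_bigr => i _.
by rewrite ge0_integral_mscale// integral_dirac.
Qed.

(** The formula for nonnegative integrands is applied to the positive and negative parts of [f], and
    the two finite sums are subtracted. *)
Lemma pair_diracs m a y x (f : X -> R) : continuous f ->
  pair (diracs m a y x) f = (\sum_(i < m) `|a i x| * f (y i))%:E.
Proof.
move=> /Bd_measurable_fun mf; rewrite /pair integralE.
have mfE := (@measurable_EFinP _ _ _ _ _).2 mf.
rewrite !ge0_integral_diracs//; last 2 first.
- exact: measurable_funeneg.
- exact: measurable_funepos.
rewrite (eq_bigr (fun i : 'I_m =>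
    (`|a i x| * Num.max (f (y i)) 0)%:E)); last first.
  by move=> i _; rewrite diracT mul1e funeposE EFinM EFin_max.
rewrite [X in (_ - X)%E](eq_bigr (fun i : 'I_m =>
    (`|a i x| * Num.max (- f (y i)) 0)%:E)); last first.
  by move=> i _; rewrite diracT mul1e funenegE EFinM EFin_max.
rewrite !sumEFin -EFinB -sumrB; congr EFin; apply: eq_bigr => i _.
rewrite -mulrBr; congr (_ * _).
have [f0|/ltW f0] := leP 0 (f (y i)).
  by rewrite max_r ?subr0// oppr_le0.
by rewrite max_l ?oppr_ge0// sub0r opprK.
Qed.

Lemma gint_diracs m a y x (g : X -> R) :
  {within ~` [set 0], continuous g} -> (forall z, z != 0 -> 0 <= g z) ->
  (forall i, (i < m)%N -> y i != 0) ->
  gint (diracs m a y x) g = (\sum_(i < m) `|a i x| * g (y i))%:E.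
Proof.
move=> cg g0 y0; rewrite /gint.
have mg := Bd_measurable_fun_within (@open_neq0 R d) cg.
rewrite ge0_integral_diracs; last 3 first.
- exact: (Bd_measurable_open (@open_neq0 R d)).
- exact/measurable_EFinP.
- by move=> z z0; rewrite lee_fin g0//; exact/eqP.
rewrite -sumEFin; apply: eq_bigr => i _.
by rewrite diracE mem_set ?mul1e//=; exact/eqP/y0.
Qed.

Lemma Mplus_diracs m a y x : (forall i, (i < m)%N -> y i != 0) ->
  Mplus (diracs m a y x).
Proof.
move=> y0; split.
  rewrite diracsE big1// => i _; rewrite diracE memNset ?mule0//= => yi0.
  by have := y0 _ (ltn_ord i); rewrite yi0 eqxx.
move=> K _ _; rewrite diracsE.
rewrite (eq_bigr (fun i : 'I_m => (`|a i x| * (y i \in K)%:R)%:E)).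
  by rewrite sumEFin ltry.
by move=> i _; rewrite diracE EFinM.
Qed.

Lemma diracs_tail m a y x (r : R) :
  (forall i, (i < m)%N -> enorm (y i) <= r) ->
  diracs m a y x ([set z | r < enorm z] : set (Bd R d)) = 0%E.
Proof.
move=> yr; rewrite diracsE big1// => i _.
by rewrite diracE memNset ?mule0//= ltNge yr.
Qed.

Lemma diracs_kern_measurable m a y :
  (forall i, (i < m)%N -> measurable_fun [set: Bd R d] (a i : Bd R d -> R)) ->
  kern_measurable (diracs m a y).
Proof.
move=> ma f [cf _].
have -> : (fun x : Bd R d => pair (diracs m a y x) f) =
    EFin \o fun x : Bd R d => \sum_(i < m) `|a i x| * f (y i).
  by apply/funext => x; rewrite pair_diracs.
apply/measurable_EFinP; apply: measurable_sum => i.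
apply: measurable_funM => //.
by apply: measurableT_comp => //; exact: ma.
Qed.

(** The atoms do not move with [x], so a single radius leaves no mass outside for every [x]; this
    settles the tail conditions of [Kg] and [bp_cvg]. *)
Lemma finite_points_bounded m y :
  exists r0 : R, forall i, (i < m)%N -> enorm (y i) <= r0.
Proof.
exists (\sum_(j < m) enorm (y j)) => i im.
rewrite (bigD1 (Ordinal im))//= lerDl sumr_ge0// => j _; exact: sqrtr_ge0.
Qed.

Context (g : X -> R).
Hypothesis g_cont : {within ~` [set 0], continuous g}.
Hypothesis g_ge0 : forall z, z != 0 -> 0 <= g z.

Lemma diracs_Kg m a y (M : R) :
  (forall i, (i < m)%N -> y i != 0) ->
  (forall i, (i < m)%N -> measurable_fun [set: Bd R d] (a i : Bd R d -> R)) ->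
  (forall x, \sum_(i < m) `|a i x| * g (y i) <= M) ->
  Kg g (diracs m a y).
Proof.
move=> y0 ma aM; split.
- by move=> x; exact: Mplus_diracs.
- exact: diracs_kern_measurable.
- by exists M => x; rewrite gint_diracs// lee_fin.
- move=> K cK e e0; have [r0 yr0] := finite_points_bounded m y.
  exists r0 => r r0r x Kx; rewrite diracs_tail ?lee_fin ?ltW// => i im.
  by rewrite (le_trans (yr0 _ im)).
Qed.

Lemma diracs_bp_cvg m (an : nat -> nat -> X -> R) a y (M : R) :
  (forall i, (i < m)%N -> y i != 0) ->
  (forall n x, \sum_(i < m) `|an n i x| * g (y i) <= M) ->
  (forall i x, (i < m)%N -> an n i x @[n --> \oo] --> a i x) ->
  bp_cvg g (fun n => diracs m (an n) y) (diracs m a y).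
Proof.
move=> y0 anM ana; split.
- by exists M => n x; rewrite gint_diracs// lee_fin.
- move=> x f [cf _]; rewrite pair_diracs//.
  under eq_fun do rewrite pair_diracs//.
  apply: cvg_EFin; first exact: nearW.
  apply: cvg_big => [|i _]; first exact: add_continuous.
  apply: cvgM; last exact: cvg_cst.
  by apply: cvg_norm; exact: ana.
- move=> K cK e e0; have [r0 yr0] := finite_points_bounded m y.
  exists r0 => r r0r n x Kx; rewrite diracs_tail ?lee_fin ?ltW// => i im.
  by rewrite (le_trans (yr0 _ im)).
Qed.

(** * Truncation of coefficients *)

(** The tent [N - |x|] caps the height and cuts off the support at once, while preserving
    continuity. *)
Definition trunc (N : R) (h : X -> R) (x : X) : R :=
  Num.min (Num.max (N - `|x|) 0) `|h x|.

Lemma trunc_ge0 N h x : 0 <= trunc N h x.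
Proof. by rewrite le_min normr_ge0 le_max lexx orbT. Qed.

Lemma trunc_le N h x : trunc N h x <= `|N|.
Proof.
rewrite ge_min; apply/orP; left; rewrite ge_max normr_ge0 andbT.
by rewrite lerBlDr (le_trans (ler_norm N))// lerDl.
Qed.

Lemma trunc_le_norm N h x : trunc N h x <= `|h x|.
Proof. by rewrite ge_min lexx orbT. Qed.

Lemma trunc_eq0 N h x : N < `|x| -> trunc N h x = 0.
Proof.
move=> Nx; rewrite /trunc (max_r (x:=N - `|x|)) ?min_l//.
by rewrite subr_le0 ltW.
Qed.

(** Values and points both vary, which covers continuity in [x] as well as limits of coefficients at
    a fixed point. *)
Lemma cvg_trunc N (T : Type) (F : set_system T) (FF : Filter F)
    (hn : T -> R) (xn : T -> X) h x :
  hn @ F --> h x -> xn @ F --> x ->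
  Num.min (Num.max (N - `|xn t|) 0) `|hn t| @[t --> F] --> trunc N h x.
Proof.
move=> hnh xnx; apply: cvg_minr; last exact: cvg_norm.
apply: cvg_maxr; last exact: cvg_cst.
by apply: cvgB; [exact: cvg_cst|exact: cvg_norm].
Qed.

Lemma trunc_continuous N h : continuous h -> continuous (trunc N h).
Proof. move=> ch x; apply: (@cvg_trunc N _ _ (nbhs_filter x) h id h x) => //.
exact: ch. Qed.

Lemma trunc_measurable N h : measurable_fun [set: Bd R d] (h : Bd R d -> R) ->
  measurable_fun [set: Bd R d] (trunc N h : Bd R d -> R).
Proof.
move=> mh; apply: measurable_minr; last by apply: measurableT_comp.
apply: Bd_measurable_fun => x.
apply: (@cvg_maxr _ _ _ (nbhs_filter x)); last exact: cvg_cst.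
apply: (@cvgB _ _ _ _ (nbhs_filter x)); first exact: cvg_cst.
exact: norm_continuous.
Qed.

(** * Finitely supported kernels in a bp-closed class *)

Context (S : set (kern R d)).
Hypothesis Ccv_S : @Ccv R d `&` Kg g `<=` S.
Hypothesis S_bp : bp_closed g S.

Let tr N a i := trunc N (a i).

(** The right-hand side does not involve [a], so it stays a uniform bound along any limit of
    coefficients. This is why truncation comes before the Baire induction. *)
Lemma sum_trunc_bound N m a y x : (forall i, (i < m)%N -> y i != 0) ->
  \sum_(i < m) `|tr N a i x| * g (y i) <= \sum_(i < m) `|N| * g (y i).
Proof.
move=> y0; apply: ler_sum => i _; rewrite ler_wpM2r ?g_ge0 ?y0//.
by rewrite ger0_norm ?trunc_le ?trunc_ge0.
Qed.

Lemma diracs_trunc_continuous_in N m a y :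
  (forall i, (i < m)%N -> y i != 0) ->
  (forall i, (i < m)%N -> continuous (a i)) ->
  S (diracs m (tr N a) y).
Proof.
move=> y0 ca; apply: Ccv_S; split; last first.
  apply: diracs_Kg => // [i im|x]; last exact: sum_trunc_bound.
  by apply: trunc_measurable; apply: Bd_measurable_fun; exact: ca.
split; first by move=> x; exact: Mplus_diracs.
split.
  move=> f [cf _] x; rewrite /continuous_at pair_diracs//.
  under eq_fun do rewrite pair_diracs//.
  have FF := nbhs_filter x; apply: cvg_EFin; first exact: nearW.
  apply: (@cvg_big _ _ +%R 0 xpredT) => [|i _]; first exact: add_continuous.
  apply: cvgM; last exact: cvg_cst.
  by apply: cvg_norm; apply: trunc_continuous; exact: ca.
exists [set x | `|x| <= N]; split; first exact: closed_normball_compact.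
move=> x /negP; rewrite -ltNge => Nx A; rewrite diracsE big1// => i _.
by rewrite /tr trunc_eq0// normr0 mul0e.
Qed.

Lemma diracs_trunc_baire_in N m a y :
  (forall i, (i < m)%N -> y i != 0) -> (forall i, (i < m)%N -> baire (a i)) ->
  S (diracs m (tr N a) y).
Proof.
move=> y0.
(* Induction on the number [k] of leading coefficients that are allowed to be merely Baire; all
   later ones are continuous. *)
suff H k : (k <= m)%N -> forall a, (forall i, (i < m)%N -> baire (a i)) ->
    (forall i, (k <= i < m)%N -> continuous (a i)) -> S (diracs m (tr N a) y).
  by move=> ba; apply: (H m) => // i; rewrite ltnNge andbN.
elim: k => [_ {}a _ ca|k IH km {}a ba ca].
  by apply: diracs_trunc_continuous_in.
(* Only coefficient [k] varies in the inner Baire induction. When it is continuous the outer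
   hypothesis applies; at a limit, [S_bp] does. *)
pose upd h i := if i == k then h else a i.
suff H h : baire h -> S (diracs m (tr N (upd h)) y).
  have -> : a = upd (a k) by apply/funext => i; rewrite /upd; case: eqP => [->|].
  by apply: H; exact: ba.
elim=> {h} [h ch|hn h bhn Shn hnh].
  apply: IH => [|i im|i /andP[ki im]]; first exact: ltnW.
  - rewrite /upd; case: eqP => _; [exact: baire_continuous|exact: ba].
  - rewrite /upd; case: eqP => [//|/eqP ik]; apply: ca.
    by rewrite im andbT ltn_neqAle eq_sym ik.
have bh : baire h by exact: baire_lim hnh.
apply: (S_bp Shn).
  apply: diracs_Kg => // [i im|x]; last exact: sum_trunc_bound.
  apply: trunc_measurable; apply: baire_Bd_measurable.
  by rewrite /upd; case: eqP => _ //; exact: ba.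
apply: diracs_bp_cvg => // [n x|i x im]; first exact: sum_trunc_bound.
rewrite /tr; apply: cvg_trunc; last exact: cvg_cst.
by rewrite /upd; case: eqP => _; [exact: hnh|exact: cvg_cst].
Qed.

(** The truncations at height [n] converge to [a] and stay below it, so [M] bounds all of them,
    whereas the bound of [sum_trunc_bound] grows with [n]. *)
Lemma diracs_in m a y (M : R) :
  (forall i, (i < m)%N -> y i != 0) ->
  (forall i, (i < m)%N -> measurable_fun [set: Bd R d] (a i : Bd R d -> R)) ->
  (forall i x, (i < m)%N -> 0 <= a i x) ->
  (forall x, \sum_(i < m) a i x * g (y i) <= M) ->
  S (diracs m a y).
Proof.
move=> y0 ma a0 aM.
have aM' x : \sum_(i < m) `|a i x| * g (y i) <= M.
  apply: le_trans (aM x); apply: ler_sum => i _.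
  by rewrite ger0_norm// a0.
apply: (S_bp (mun := fun n => diracs m (tr n%:R a) y)) => [n||].
- apply: diracs_trunc_baire_in => // i im.
  apply: baire_measurable; first exact: ma.
  by move=> x; exact: a0.
- exact: diracs_Kg aM'.
- apply: (diracs_bp_cvg (M := M)) => // [n x|i x im].
    apply: le_trans (aM' x); apply: ler_sum => i _.
    by rewrite ler_wpM2r ?g_ge0 ?y0// ger0_norm ?trunc_ge0// trunc_le_norm.
  (* The truncation is exact as soon as [n >= a i x + |x|]. *)
  apply: cvg_near_cst; near=> n; rewrite /tr /trunc min_r ger0_norm ?a0//.
  rewrite le_max; apply/orP; left; rewrite lerBrDr.
  near: n; exact: nbhs_infty_ger.
Unshelve. all: by end_near. Qed.

End Dirac_kernels.

(** * Partitions of unity on shells *)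

Section Partition.
Context (R : realType) (d : nat).
Local Notation X := 'rV[R]_d.

Lemma compact_net (K : set X) (e : R) : compact K -> 0 < e ->
  exists s : seq X, (forall z, z \in s -> K z) /\
    forall x, K x -> exists2 z, z \in s & `|x - z| < e.
Proof.
rewrite compact_cover => cK e0.
have [||D DK KD] := cK X K (fun z => ball z e).
- by move=> z _; exact: ball_open.
- by move=> z Kz; exists z => //; exact: ballxx.
exists (finmap.enum_fset D); split=> [z zD|x /KD[z /= zD]].
  by have := DK _ zD; rewrite inE.
by rewrite -ball_normE /= distrC => xz; exists z.
Qed.

(** Tents of radius [e / 2] around an [e / 4]-net are normalized by their sum and multiplied by
    [chi]. Each [y i] minimizes [g] on the part of [K] within [e / 2] of the centre, hence is within
    [e] of every point of its cell. *)
Lemma compact_partition (K : set X) (chi g : X -> R) (e : R) :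
  compact K -> 0 < e -> continuous chi -> (forall z, 0 <= chi z) ->
  (forall z, chi z != 0 -> K z) -> {within K, continuous g} ->
  exists m (y : nat -> X) (psi : nat -> X -> R),
    [/\ forall i, (i < m)%N -> K (y i),
        forall i, continuous (psi i),
        forall i z, 0 <= psi i z,
        forall i z, (i < m)%N -> psi i z != 0 ->
          [/\ K z, `|z - y i| <= e & g (y i) <= g z] &
        forall z, \sum_(i < m) psi i z = chi z].
Proof.
move=> cK e0 cchi chi0 chiK cg.
have e20 : 0 < e / 2 by rewrite divr_gt0.
have e40 : 0 < e / 2 / 2 by rewrite divr_gt0.
have [s [sK Ks]] := compact_net cK e40.
pose c i : X := nth 0 s i.
have cK' i : (i < size s)%N -> K (c i) by move=> si; apply: sK; exact: mem_nth.
pose phi i z : R := Num.max (e / 2 - `|z - c i|) 0.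
have phi0 i z : 0 <= phi i z by rewrite le_max lexx orbT.
have cphi i : continuous (phi i).
  move=> z; have FF := nbhs_filter z; apply: cvg_maxr; last exact: cvg_cst.
  apply: cvgB; first exact: cvg_cst.
  apply: cvg_norm; apply: cvgB; [exact: cvg_id|exact: cvg_cst].
(* The floor [e / 4] makes the denominator positive everywhere. On [K] it changes nothing, since
   some net point within [e / 4] has a tent of height at least [e / 4]; off [K] the factor [chi]
   vanishes. *)
pose den z : R := Num.max (\sum_(i < size s) phi i z) (e / 2 / 2).
have den0 z : 0 < den z by rewrite lt_max e40 orbT.
have cden : continuous den.
  move=> z; have FF := nbhs_filter z; apply: cvg_maxr; last exact: cvg_cst.
  apply: (@cvg_big _ _ +%R 0 xpredT) => [|i _]; first exact: add_continuous.
  exact: cphi.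
have denE z : K z -> den z = \sum_(i < size s) phi i z.
  move=> /Ks[w ws zw]; apply: max_l.
  have ws' : (index w s < size s)%N by rewrite index_mem.
  rewrite (bigD1 (Ordinal ws'))//=; apply: ler_wpDr; first exact: sumr_ge0.
  rewrite le_max /c nth_index//; apply/orP; left.
  by rewrite lerBrDr -lerBrDl (le_trans (ltW zw))// lerBrDr -splitr.
pose L i := K `&` [set z | `|z - c i| <= e / 2].
(* Each piece [L i] is compact and contains its centre, so a minimizer exists; indices beyond the
   net get the default [0]. *)
have [y yL] : {y : nat -> X & forall i, (i < size s)%N ->
    L i (y i) /\ forall t, L i t -> g (y i) <= g t}.
  apply: (@choice _ _ (fun i w => (i < size s)%N ->
    L i w /\ forall t, L i t -> g w <= g t)) => i.
  have [si|_] := ltnP i (size s); last by exists 0.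
  have [|||w /set_mem Lw wmin] := @EVT_min_rV R d g (L i).
  - by exists (c i); split; [exact: cK'|rewrite /= subrr normr0 ltW].
  - apply: compact_closedI => //.
    rewrite -[[set z | _]]/((fun z => `|z - c i|) @^-1` [set t | t <= e / 2]).
    apply: closed_comp => [z _|]; last exact: closed_le.
    have FF := nbhs_filter z; apply: cvg_norm.
    by apply: cvgB; [exact: cvg_id|exact: cvg_cst].
  - by apply: continuous_subspaceW cg; exact: subIsetl.
  - by exists w => _; split=> // t Lt; apply: wmin; exact/mem_set.
exists (size s), y, (fun i z => chi z * (phi i z / den z)); split.
- by move=> i /yL[[]].
- move=> i z; have FF := nbhs_filter z; apply: cvgM; first exact: cchi.
  apply: cvgM; first exact: cphi.
  by apply: cvgV; [rewrite gt_eqF|exact: cden].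
- by move=> i z; rewrite mulr_ge0// divr_ge0// ltW.
- move=> i z si; rewrite !mulf_eq0 !negb_or => /andP[chiz /andP[phiz _]].
  have Kz := chiK _ chiz; have [[Ky yc] ymin] := yL _ si.
  have zc : `|z - c i| <= e / 2.
    rewrite leNgt; apply: contra phiz => zc.
    by rewrite /phi max_r// subr_le0 ltW.
  split=> //; last by apply: ymin.
  rewrite -(subrKA (c i)) (le_trans (ler_normD _ _))// [leRHS]splitr lerD//.
  by rewrite distrC.
- move=> z; rewrite -mulr_sumr -mulr_suml.
  have [->|/chiK Kz] := eqVneq (chi z) 0; first by rewrite mul0r.
  by rewrite -denE// divff ?mulr1// gt_eqF.
Qed.

(** * Cutoffs and partitions on growing shells *)

(** A trapezoid in [|z|]: it is 1 for [2 / (n + 1) <= |z| <= n] and 0 outside the shell from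
    [1 / (n + 1)] to [n + 1]. *)
Definition shell_cutoff n (z : X) : R :=
  Num.max (Num.min 1 (Num.min (n.+1%:R * `|z| - 1) (n.+1%:R - `|z|))) 0.

Lemma shell_cutoff_ge0 n z : 0 <= shell_cutoff n z.
Proof. by rewrite le_max lexx orbT. Qed.

Lemma shell_cutoff_le1 n z : shell_cutoff n z <= 1.
Proof. by rewrite ge_max ler01 andbT ge_min lexx. Qed.

Lemma shell_cutoff_continuous n : continuous (shell_cutoff n).
Proof.
move=> z; have FF := nbhs_filter z; have cn := @norm_continuous _ _ z.
apply: cvg_maxr; last exact: cvg_cst.
apply: cvg_minr; first exact: cvg_cst.
apply: cvg_minr; last by apply: cvgB => //; exact: cvg_cst.
by apply: cvgB; [apply: cvgM => //; exact: cvg_cst|exact: cvg_cst].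
Qed.

Lemma shell_cutoff_neq0 n z : shell_cutoff n z != 0 ->
  n.+1%:R^-1 <= `|z| <= n.+1%:R.
Proof.
move=> nz; have : 0 < shell_cutoff n z by rewrite lt_def nz shell_cutoff_ge0.
rewrite lt_max ltxx orbF !lt_min => /and3P[_ + +].
rewrite !subr_gt0 => zl /ltW ->; rewrite andbT.
by rewrite -div1r ler_pdivrMr// mulrC ltW.
Qed.

Lemma shell_cutoff_near1 z : z != 0 ->
  \forall n \near \oo, shell_cutoff n z = 1.
Proof.
move=> z0; have nz : 0 < `|z| by rewrite normr_gt0.
near=> n; rewrite /shell_cutoff min_l ?max_l// le_min; apply/andP; split.
  rewrite lerBrDr -[1 + 1]/2%:R -ler_pdivrMr//.
  apply: (@le_trans _ _ n%:R); last by rewrite ler_nat.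
  by near: n; exact: nbhs_infty_ger.
rewrite lerBrDl -lerBrDr -[leRHS](_ : n%:R = _); last by rewrite -natr1 addrK.
by near: n; exact: nbhs_infty_ger.
Unshelve. all: by end_near. Qed.

Lemma shell_partition (g : X -> R) n : {within ~` [set 0], continuous g} ->
  exists m (y : nat -> X) (psi : nat -> X -> R),
    [/\ forall i, (i < m)%N -> y i != 0,
        forall i, (i < m)%N -> Cc0 (psi i),
        forall i z, 0 <= psi i z,
        forall i z, (i < m)%N -> psi i z != 0 ->
          [/\ z != 0, `|z - y i| <= `|z| / 2, `|z - y i| <= n.+1%:R^-1 &
              g (y i) <= g z] &
        forall z, \sum_(i < m) psi i z = shell_cutoff n z].
Proof.
move=> cg; pose K := [set z : X | n.+1%:R^-1 <= `|z| <= n.+1%:R].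
have K0 z : K z -> z != 0.
  by move=> /andP[+ _]; apply: contraTneq => ->; rewrite normr0 -ltNge invr_gt0.
(* Half the inner radius as mesh gives both bounds: it is at most [|z| / 2] on the shell, so [|y i|]
   and [|z|] are comparable, and it tends to 0. *)
have n20 : 0 < n.+1%:R^-1 / 2 :> R by rewrite divr_gt0.
have [|m [y [psi [yK cpsi psi0 psiP psiE]]]] := @compact_partition K
    (shell_cutoff n) g _ (@shell_compact _ _ _ _) n20
    (@shell_cutoff_continuous n) (@shell_cutoff_ge0 n) (@shell_cutoff_neq0 n).
  apply: continuous_subspaceW cg => z /K0/eqP; exact.
exists m, y, psi; split=> //.
- by move=> i im; exact/K0/yK.
- move=> i im; split; first exact: cpsi.
  exists K; split; first exact: shell_compact.
    by move/K0; rewrite eqxx.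
  by move=> z Kz; apply/eqP; apply: contra_notT Kz => /psiP[].
- move=> i z im /psiP[]// Kz zy gyz; split=> //; first exact: K0.
    apply: (le_trans zy); rewrite ler_wpM2r//.
    by case/andP: Kz.
  by apply: (le_trans zy); rewrite ler_pdivrMr// ler_peMr// ler1n.
Qed.

End Partition.

(** * Discretization of a kernel *)

Section Cc0_integrals.
Context (R : realType) (d : nat).
Local Notation X := 'rV[R]_d.
Implicit Types (nu : msr R d) (f : X -> R).

Lemma Cc0_bounded f : Cc0 f -> exists C, 0 <= C /\ forall z, `|f z| <= C.
Proof.
move=> [cf [K [cK _ fK]]].
have /ex_strict_bound_gt0[C C0 fC] : bounded_set (f @` K).
  apply: compact_bounded; apply: continuous_compact => //.
  exact: continuous_subspaceT.
exists C; split=> [|z]; first exact: ltW.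
have [Kz|Kz] := pselect (K z); first by apply: ltW; apply: fC; exists z.
by rewrite fK// normr0 ltW.
Qed.

Lemma Cc0_support f : Cc0 f ->
  exists r s, 0 < r /\ forall z, f z != 0 -> r <= `|z| <= s.
Proof.
move=> [cf [K [cK K0 fK]]].
have /ex_strict_bound_gt0[s _ Ks] := compact_bounded cK.
have /nbhs_ballP[r /= r0 rK] : nbhs (0 : X) (~` K).
  apply: open_nbhs_nbhs; split=> //; rewrite openC.
  by apply: compact_closed => //; exact: norm_hausdorff.
exists r, s; split=> // z fz.
have Kz : K z by apply: contrapT => /fK fz0; rewrite fz0 eqxx in fz.
rewrite (ltW (Ks _ Kz)) andbT leNgt; apply/negP => zr.
by apply: (rK z) => //; rewrite -ball_normE /= sub0r normrN.
Qed.

Lemma indic_integrable nu (C : R) (K : set X) :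
  Mplus nu -> compact K -> ~ K 0 ->
  nu.-integrable [set: Bd R d] (fun z : Bd R d => (C * \1_K z)%:E).
Proof.
move=> [_ nuK] cK K0; have mK := Bd_measurable_compact cK.
under eq_fun do rewrite EFinM.
apply: integrableZl => //; apply/integrableP; split.
  exact/measurable_EFinP.
under eq_integral do rewrite gee0_abs ?lee_fin//.
by rewrite integral_indic// setIT; exact: nuK.
Qed.

Lemma Cc0_integrable nu f : Mplus nu -> Cc0 f ->
  nu.-integrable [set: Bd R d] (fun z : Bd R d => (f z)%:E).
Proof.
move=> Mnu cf; have [C [C0 fC]] := Cc0_bounded cf.
case: cf => cf [K [cK K0 fK]].
apply: le_integrable (indic_integrable C Mnu cK K0) => //.
  by apply/measurable_EFinP; exact: Bd_measurable_fun.
move=> z _; rewrite /= lee_fin [leRHS]ger0_norm ?mulr_ge0// indicE.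
have [Kz|Kz] := pselect (K z); first by rewrite mem_set// mulr1.
by rewrite fK// normr0 mulr_ge0.
Qed.

(** Turns a sum over atoms into an integral against [nu] itself, so that every estimate on the
    discretization reduces to a pointwise one on the integrand. *)
Lemma sum_pair nu m (psi : nat -> X -> R) (h : nat -> R) :
  Mplus nu -> (forall i, (i < m)%N -> Cc0 (psi i)) ->
  (\sum_(i < m) fine (pair nu (psi i)) * h i)%:E =
  (\int[nu]_(z in [set: Bd R d]) (\sum_(i < m) psi i z * h i)%:E)%E.
Proof.
move=> Mnu cpsi.
have ipsi (i : 'I_m) := Cc0_integrable Mnu (cpsi i (ltn_ord i)).
under eq_integral do rewrite -sumEFin.
rewrite integral_sum//; last first.
  by move=> i; under eq_fun do rewrite EFinM muleC; exact: integrableZl.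
rewrite -sumEFin; apply: eq_bigr => i _.
under eq_integral do rewrite EFinM.
rewrite integralZr// EFinM fineK//.
exact: (integrable_fin_num measurableT (ipsi i)).
Qed.

End Cc0_integrals.

Section Discretization.
Context (R : realType) (d : nat).
Local Notation X := 'rV[R]_d.
Context (g : X -> R).
Hypothesis g_cont : {within ~` [set 0], continuous g}.
Hypothesis g_ge0 : forall z, z != 0 -> 0 <= g z.

Context (m : nat -> nat) (y : nat -> nat -> X) (psi : nat -> nat -> X -> R).
Hypothesis y_neq0 : forall n i, (i < m n)%N -> y n i != 0.
Hypothesis psi_Cc0 : forall n i, (i < m n)%N -> Cc0 (psi n i).
Hypothesis psi_ge0 : forall n i z, 0 <= psi n i z.
Hypothesis psi_near : forall n i z, (i < m n)%N -> psi n i z != 0 ->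
  [/\ z != 0, `|z - y n i| <= `|z| / 2, `|z - y n i| <= n.+1%:R^-1 &
      g (y n i) <= g z].
Hypothesis psi_sum : forall n z,
  \sum_(i < m n) psi n i z = shell_cutoff n z.

Definition discretization (mu : kern R d) n : kern R d :=
  diracs (m n) (fun i x => fine (pair (mu x) (psi n i))) (y n).

Lemma psi_term_le n i z (h : X -> R) (c : R) : (i < m n)%N ->
  (z != 0 -> `|z - y n i| <= `|z| / 2 -> g (y n i) <= g z -> h (y n i) <= c) ->
  psi n i z * h (y n i) <= psi n i z * c.
Proof.
move=> im hc; have [->|pz] := eqVneq (psi n i z) 0; first by rewrite !mul0r.
by rewrite ler_wpM2l//; have [? ? _ ?] := psi_near im pz; exact: hc.
Qed.

(** The weights [psi n i z] are nonnegative with sum at most 1, and only atoms near [z] count. It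
    serves for [g], for tail indicators and for [|f|]. *)
Lemma psi_sum_le n z (h : X -> R) (c : R) : 0 <= c ->
  (forall i, (i < m n)%N -> z != 0 -> `|z - y n i| <= `|z| / 2 ->
    g (y n i) <= g z -> h (y n i) <= c) ->
  \sum_(i < m n) psi n i z * h (y n i) <= c.
Proof.
move=> c0 hc; apply: (@le_trans _ _ (shell_cutoff n z * c)).
  rewrite -psi_sum mulr_suml; apply: ler_sum => i _.
  by apply: psi_term_le => //; exact: hc.
by rewrite ler_piMl// shell_cutoff_le1.
Qed.

Lemma psi0 n i : (i < m n)%N -> psi n i 0 = 0.
Proof.
move=> im; apply/eqP; apply: contraT => /(psi_near im)[].
by rewrite eqxx.
Qed.

(** * Estimates for a single measure *)

Section Pointwise.
Context (nu : msr R d).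
Hypothesis Mnu : Mplus nu.
Let c n i := fine (pair nu (psi n i)).

Lemma fine_pair_ge0 n i : 0 <= c n i.
Proof.
by rewrite fine_ge0//; apply: integral_ge0 => z _; rewrite lee_fin.
Qed.

Lemma psi_sum_measurable n (h : nat -> R) :
  measurable_fun [set: Bd R d]
    (fun z : Bd R d => (\sum_(i < m n) psi n i z * h i)%:E).
Proof.
apply/measurable_EFinP; apply: measurable_sum => i.
apply: measurable_funM => //; apply: Bd_measurable_fun.
by have [] := psi_Cc0 (ltn_ord i).
Qed.

(** By the minimizing choice of [y n i], the integrand given by [sum_pair] is at most [g z] at each
    nonzero [z]. *)
Lemma sum_gint_le n : ((\sum_(i < m n) c n i * g (y n i))%:E <= gint nu g)%E.
Proof.
rewrite (sum_pair (fun i => g (y n i)) Mnu (@psi_Cc0 n)).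
have o0 := @open_neq0 R d.
have mo0 := Bd_measurable_open o0.
rewrite /gint; set D := (~` [set (0 : X)] : set (Bd R d)).
(* The origin can be removed because every [psi n i] vanishes there. *)
have -> : (\int[nu]_(z in [set: Bd R d])
      (\sum_(i < m n) psi n i z * g (y n i))%:E =
    \int[nu]_(z in D) (\sum_(i < m n) psi n i z * g (y n i))%:E)%E.
  rewrite [RHS]integral_mkcond; apply: eq_integral => z _; rewrite patchE.
  case: ifPn => // /negP zD; have -> : z = 0.
    by apply: contrapT => z0; apply: zD; exact/mem_set.
  by rewrite big1// => i _; rewrite psi0// mul0r.
apply: ge0_le_integral => //.
- move=> z /eqP z0; rewrite lee_fin sumr_ge0// => i _.
  by rewrite mulr_ge0// g_ge0// y_neq0.
- apply: measurable_funTS.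
  exact: (psi_sum_measurable n (fun i => g (y n i))).
- by apply/measurable_EFinP; exact: (Bd_measurable_fun_within o0 g_cont).
- move=> z /eqP z0; rewrite lee_fin; apply: psi_sum_le => //; exact: g_ge0.
Qed.

(* On the cell of [y n i] one has |y n i| <= 2 |z|; the factor 2 (d + 1)
   also absorbs the comparison of the Euclidean and the sup norm. *)
Lemma sum_tail_le n (r0 r : R) : 2 * d.+1%:R * r0 <= r ->
  ((\sum_(i < m n) c n i * \1_[set z | (r < enorm z)%R] (y n i))%:E <=
   nu ([set z | (r0 < enorm z)%R] : set (Bd R d)))%E.
Proof.
move=> r0r.
rewrite (sum_pair (fun i => \1_[set z | r < enorm z] (y n i)) Mnu (@psi_Cc0 n)).
pose A : set (Bd R d) := [set z | r0 < enorm z].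
have mA : measurable A by exact: enorm_gt_measurable.
have <- : (\int[nu]_(z in setT) (\1_A z)%:E = nu A)%E.
  by rewrite integral_indic// setIT.
have mr0 : measurable_fun [set: Bd R d]
    (fun z : Bd R d => (\1_A z)%:E : \bar R).
  exact/measurable_EFinP.
apply: ge0_le_integral => //.
- by move=> z _; rewrite lee_fin sumr_ge0// => i _; rewrite mulr_ge0.
- exact: (psi_sum_measurable n (fun i => \1_[set z | r < enorm z] (y n i))).
- move=> z _; rewrite lee_fin; apply: psi_sum_le => // i im z0 zy _.
  rewrite !indicE; have [ry|//] := boolP (y n i \in _).
  rewrite inE /= in ry; rewrite mem_set// /A /=.
  have d0 : 0 < 2 * d.+1%:R :> R by rewrite mulr_gt0.
  rewrite -(ltr_pM2l d0) (le_lt_trans r0r)// (lt_le_trans ry)//.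
  rewrite (le_trans (enorm_le_norm _))// [leRHS]mulrAC [leRHS]mulrC ler_wpM2l//.
  have yz : `|y n i| <= `|z| + `|z| / 2.
    by rewrite -{1}(subKr z (y n i)) (le_trans (ler_normB _ _))// lerD.
  apply: (le_trans yz); apply: (@le_trans _ _ (`|z| * 2)); last first.
    by rewrite mulrC ler_wpM2l// norm_le_enorm.
  rewrite [leRHS]mulr_natr [leRHS]mulr2n lerD//.
  by rewrite ler_pdivrMr// ler_peMr ?ler1n.
Qed.

(** At [z != 0] the weights eventually sum to 1 and the atoms that count are within [1 / (n + 1)] of
    [z], so continuity of [f] at [z] suffices. At the origin both sides vanish. *)
Lemma psi_sum_cvg (f : X -> R) z : Cc0 f ->
  (\sum_(i < m n) psi n i z * f (y n i)) @[n --> \oo] --> f z.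
Proof.
move=> [cf [K [cK K0 fK]]].
have [->|z0] := eqVneq z 0.
  rewrite fK//; apply: cvg_near_cst; apply: nearW => n.
  by rewrite big1// => i _; rewrite psi0// mul0r.
apply/cvgrPdist_le => e e0.
have /cvgrPdist_le/(_ e e0)/nbhs_ballP[r /= r0 rf] := cf z.
near=> n.
have -> : f z = \sum_(i < m n) psi n i z * f z.
  rewrite -mulr_suml psi_sum [X in X * _](_ : _ = 1) ?mul1r//.
  by near: n; exact: shell_cutoff_near1.
rewrite -sumrB (le_trans (ler_norm_sum _ _ _))//.
apply: (@le_trans _ _ (\sum_(i < m n) psi n i z * e)); last first.
  by rewrite -mulr_suml psi_sum ler_piMl ?shell_cutoff_le1// ltW.
apply: ler_sum => i _; rewrite -mulrBr normrM ger0_norm//.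
have [->|pz] := eqVneq (psi n i z) 0; first by rewrite !mul0r.
rewrite ler_wpM2l//; apply: rf; rewrite -ball_normE /=.
have [_ _ zy _] := psi_near (ltn_ord i) pz; apply: (le_lt_trans zy).
near: n; exact: near_infty_natSinv_lt (PosNum r0).
Unshelve. all: by end_near. Qed.

(** Supplies a dominating function independent of [n], integrable because its support is compact and
    misses the origin. *)
Lemma psi_sum_bounded (f : X -> R) : Cc0 f ->
  exists (K : set X) (C : R), [/\ compact K, ~ K 0 &
    forall n z, `|\sum_(i < m n) psi n i z * f (y n i)| <= C * \1_K z].
Proof.
move=> cf; have [C [C0 fC]] := Cc0_bounded cf.
have [r [s [r0 frs]]] := Cc0_support cf.
(* If [z] is within [|z| / 2] of an atom [y], then [|y| <= 2 * |z|] and [|z| <= 2 * |y|]; the shell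
   containing the support of [f] is therefore widened by a factor 2 on each side. *)
exists [set z | r / 2 <= `|z| <= 2 * s], C; split; first exact: shell_compact.
  by rewrite /= normr0 => /andP[+ _]; rewrite leNgt divr_gt0.
move=> n z; rewrite (le_trans (ler_norm_sum _ _ _))//.
rewrite (eq_bigr (fun i : 'I_(m n) =>
    psi n i z * (Num.norm \o f) (y n i))); last first.
  by move=> i _; rewrite normrM ger0_norm.
apply: psi_sum_le; first by rewrite mulr_ge0.
move=> i im z0 zy _ /=; rewrite indicE.
have [fy|/frs/andP[ry ys]] := eqVneq (f (y n i)) 0.
  by rewrite fy normr0 mulr_ge0.
rewrite mem_set ?mulr1//=; apply/andP; split.
  have yz : `|y n i| <= `|z| + `|z| / 2.
    by rewrite -{1}(subKr z (y n i)) (le_trans (ler_normB _ _))// lerD.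
  rewrite ler_pdivrMr// (le_trans ry)// (le_trans yz)//.
  rewrite [leRHS]mulr_natr [leRHS]mulr2n lerD//.
  by rewrite ler_pdivrMr// ler_peMr ?ler1n.
have : `|z| <= `|z| / 2 + `|y n i|.
  by rewrite -{1}(subrK (y n i) z) (le_trans (ler_normD _ _))// lerD.
rewrite -lerBlDl {1}(splitr `|z|) addrK ler_pdivrMr// mulrC => /le_trans; apply.
by rewrite ler_wpM2l.
Qed.

Lemma sum_pair_cvg (f : X -> R) : Cc0 f ->
  (\sum_(i < m n) c n i * f (y n i))%:E @[n --> \oo] --> pair nu f.
Proof.
move=> cf; have [K [C [cK K0 fKC]]] := psi_sum_bounded cf.
under eq_fun do rewrite (sum_pair (fun i => f (y _ i)) Mnu (@psi_Cc0 _)).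
have [] := @dominated_convergence _ (Bd R d) R nu setT measurableT
  (fun n z => (\sum_(i < m n) psi n i z * f (y n i))%:E) (EFin \o f)
  (fun z => (C * \1_K z)%:E).
- by move=> n; exact: (psi_sum_measurable n (fun i => f (y n i))).
- by apply/measurable_EFinP; apply: Bd_measurable_fun; case: cf.
- apply: aeW => z _; apply: cvg_EFin; first exact: nearW.
  exact: psi_sum_cvg.
- exact: indic_integrable.
- by apply: aeW => z n _; rewrite /= lee_fin; exact: fKC.
- by move=> _ _.
Qed.

End Pointwise.

Lemma gint_discretization mu n x :
  gint (discretization mu n x) g =
  (\sum_(i < m n) fine (pair (mu x) (psi n i)) * g (y n i))%:E.
Proof.
rewrite gint_diracs//; last exact: y_neq0.
by congr EFin; apply: eq_bigr => i _; rewrite ger0_norm// fine_pair_ge0.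
Qed.

(** The coefficients are measurable in [x] because they test [mu] against functions in [Cc0], and
    [sum_gint_le] transfers the bound [M] to them. *)
Lemma discretization_in (S : set (kern R d)) mu n :
  @Ccv R d `&` Kg g `<=` S -> bp_closed g S -> Kg g mu ->
  S (discretization mu n).
Proof.
move=> CcvS Sbp [Mmu mmu [M muM] _].
apply: (diracs_in g_cont g_ge0 CcvS Sbp (M := M)).
- exact: y_neq0.
- move=> i im; apply: measurableT_comp; first exact: fine_measurable.
  by apply: mmu; exact: psi_Cc0.
- by move=> i x _; exact: fine_pair_ge0.
- by move=> x; rewrite -lee_fin (le_trans (sum_gint_le (Mmu x) n)).
Qed.

Lemma discretization_bp_cvg mu : Kg g mu ->
  bp_cvg g (discretization mu) mu.
Proof.
move=> [Mmu mmu [M muM] mutail]; split.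
- exists M => n x.
  by rewrite gint_discretization (le_trans (sum_gint_le (Mmu x) n)).
- move=> x f cf; have [cf' _] := cf.
  under eq_fun do rewrite pair_diracs//.
  apply: cvg_trans (sum_pair_cvg (Mmu x) cf); apply: near_eq_cvg.
  apply: nearW => n; congr EFin; apply: eq_bigr => i _.
  by rewrite ger0_norm// fine_pair_ge0.
- move=> K cK e e0; have [r0 Kr0] := mutail K cK e e0.
  exists (2 * d.+1%:R * r0) => r r0r n x Kx.
  apply: le_trans (Kr0 r0 (lexx _) x Kx).
  apply: le_trans (sum_tail_le (Mmu x) n r0r).
  rewrite diracsE -sumEFin le_eqVlt; apply/orP; left; apply/eqP.
  by apply: eq_bigr => i _; rewrite ger0_norm ?fine_pair_ge0// EFinM.
Qed.

End Discretization.

(** * Density *)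

Theorem theoremA5 (R : realType) (d : nat) (g : 'rV[R]_d -> R)
  (g_cont : {within ~` [set 0], continuous g})
  (g_ge0 : forall y : 'rV[R]_d, y != 0 -> 0 <= g y) :
  forall S : set (kern R d),
    S `<=` Kg g -> @Ccv R d `&` Kg g `<=` S -> bp_closed g S -> S = Kg g.
Proof.
move=> S SKg CcvS Sbp; apply/seteqP; split=> // mu Kmu.
(* One partition is chosen for each [n]; it depends on [g] but not on [mu] or [x], so the atoms are
   constant in [x]. *)
have [m /choice[y /choice[psi P]]] := choice (fun n => shell_partition n g_cont).
have y0 n i : (i < m n)%N -> y n i != 0 by case: (P n) => + _ _ _ _; apply.
have pC n i : (i < m n)%N -> Cc0 (psi n i) by case: (P n) => _ + _ _ _; apply.
have p0 n i z : 0 <= psi n i z by case: (P n) => _ _ + _ _; apply.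
have pn n i z : (i < m n)%N -> psi n i z != 0 ->
    [/\ z != 0, `|z - y n i| <= `|z| / 2, `|z - y n i| <= n.+1%:R^-1 &
        g (y n i) <= g z] by case: (P n) => _ _ _ + _; apply.
have ps n z : \sum_(i < m n) psi n i z = shell_cutoff n z.
  by case: (P n) => _ _ _ _; apply.
apply: (Sbp (discretization m y psi mu)) => // [n|].
  exact: discretization_in.
exact: discretization_bp_cvg.
Qed.
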